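(* Let $n=4m>1$ and let $H$ be an $n\times n$ $(\pm1)$-matrix whose defining row $H_1$ contains exactly two $1$-alternating sequences (i.e. $\alpha_1=2$). Then $H$ is not a circulant Hadamard matrix.
   Context: A Hadamard matrix is an $n\times n$ matrix with entries in $\{+1,-1\}$ whose rows are mutually orthogonal. It is circulant if, writing its first row (the defining row) as $H_1=(h_1,\ldots,h_n)$, its $i$-th row is $H_i=(h_{1-i+1},\ldots,h_{n-i+1})$ with subscripts taken modulo $n$. Regard $H_1$ as a circular (cyclic) sequence of $+1$'s and $-1$'s. A block is a maximal set of cyclically consecutive entries of $H_1$ that are all equal; its size is its number of entries. A $1$-alternating sequence is a maximal run of cyclically consecutive blocks all of size exactly $1$, and $\alpha_1$ denotes the number of such sequences. *)

(* Defs.v *)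
From HB Require Import structures.
From mathcomp Require Import all_boot all_order all_algebra.

Set Implicit Arguments.
Unset Strict Implicit.
Unset Printing Implicit Defensive.

Import Order.TTheory GRing.Theory Num.Theory.
Local Open Scope ring_scope.

Definition pm1_mx (m n : nat) (H : 'M[int]_(m, n)) : Prop :=
  forall i j, H i j = 1 \/ H i j = -1.

Definition hadamard (n : nat) (H : 'M[int]_n) : Prop :=
  pm1_mx H /\ (forall i j, i != j -> \sum_k H i k * H j k = 0).

Definition defining_row (p : nat) (H : 'M[int]_p.+1) : 'rV[int]_p.+1 :=
  row ord0 H.

(* [j - i] is the subtraction modulo p.+1 of 'I_p.+1. *)
Definition circulant (p : nat) (H : 'M[int]_p.+1) : Prop :=
  forall i j, H i j = defining_row H ord0 (j - i).

(* [A] is a nonempty set of consecutive elements for the successor map [f],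
   i.e. A = {x, f x, ..., f^(#|A| - 1) x} for some x. On a cycle, the whole
   cycle is such a set. *)
Definition consecutive (T : finType) (f : T -> T) (A : {set T}) : bool :=
  (A != set0) && [exists x, A == [set y in traject f x #|A|]].

Definition constant_on (n : nat) (h : 'rV[int]_n) (B : {set 'I_n}) : bool :=
  [forall x in B, forall y in B, h ord0 x == h ord0 y].

Definition is_block (n : nat) (h : 'rV[int]_n) (B : {set 'I_n}) : bool :=
  maxset (fun C : {set 'I_n} => consecutive (@ordS n) C && constant_on h C) B.

Definition blocks (n : nat) (h : 'rV[int]_n) : {set {set 'I_n}} :=
  [set B | is_block h B].

(* The block starting right after the last entry of [B]; when [B] is the whole
   circle, there is no other block and [B] follows itself. *)
Definition next_block (n : nat) (h : 'rV[int]_n) (B : {set 'I_n}) : {set 'I_n} :=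
  if [pick x in B | ordS x \notin B] is Some x then pblock (blocks h) (ordS x)
  else B.

Definition is_one_alternating (n : nat) (h : 'rV[int]_n)
    (S : {set {set 'I_n}}) : bool :=
  maxset (fun U : {set {set 'I_n}} =>
            consecutive (next_block h) U
            && (U \subset [set B in blocks h | #|B| == 1%N])) S.

Definition alpha1 (n : nat) (h : 'rV[int]_n) : nat :=
  #|[set S | is_one_alternating h S]|.

(* Main.v *)
(* Let h be the defining row and n its length; all its nontrivial periodic
   autocorrelations vanish. Each window (x, x, -x, x) of h starts a
   1-alternating sequence, so at most alpha_1 = 2 such windows exist. By the
   autocorrelations at lags 1, 2, 3 their number is (n - Q) / 8, where Q is the
   sum of the products q_j = h_j h_(j+1) h_(j+2) h_(j+3); hence Q >= n - 16.
   Now q_j q_(j+1) = h_j h_(j+4), and x y >= x + y - 1 for signs x, y, so the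
   autocorrelation at lag 4 gives 0 >= 2 Q - n. Therefore n <= 32. Moreover n is
   the square of the row sum, so n is 4 or 16. No row of length 16 has vanishing
   autocorrelations, by exhaustion, and for n = 4 the lags 1 and 2 leave a
   single block of size 1, so alpha_1 <= 1. *)
Require Import Defs.
From HB Require Import structures.
From mathcomp Require Import all_boot all_order all_algebra.
From mathcomp Require Import zify lra.

Set Implicit Arguments.
Unset Strict Implicit.
Unset Printing Implicit Defensive.

Import Order.TTheory GRing.Theory Num.Theory.
Local Open Scope ring_scope.

(** * Periodic autocorrelation of sign rows *)

Section Autocorrelation.

Variables (p : nat) (h : 'rV[int]_p.+1).

Definition autocorr (k : 'I_p.+1) : int := \sum_j h ord0 j * h ord0 (j + k).

Definition pm1_row : Prop := forall j, h ord0 j = 1 \/ h ord0 j = -1.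

Definition perfect_row : Prop := forall k, k != 0 -> autocorr k = 0.

(** The class of 1 modulo [p.+1]; lag [k] is then [unit_step *+ k]. *)
Definition unit_step : 'I_p.+1 := ordS ord0.

Lemma ordS_add (j : 'I_p.+1) : ordS j = j + unit_step.
Proof. by apply: val_inj; rewrite /= modnDmr addn1. Qed.

Lemma val_unit_step_mul k : (k < p.+1)%N -> (unit_step *+ k : 'I_p.+1) = k :> nat.
Proof.
elim: k => [|k IHk] ltk; first by rewrite mulr0n.
by rewrite mulrSr -ordS_add /= IHk ?modn_small // ltnW.
Qed.

Lemma unit_step_mul_neq0 k : (0 < k < p.+1)%N -> unit_step *+ k != 0.
Proof.
by case/andP=> k0 kp; rewrite -val_eqE /= val_unit_step_mul // -lt0n.
Qed.

Lemma sum_shift (k : 'I_p.+1) (F : 'I_p.+1 -> int) :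
  \sum_j F (j + k) = \sum_j F j.
Proof. by rewrite [RHS](reindex_inj (addIr k)). Qed.

(** Grouping the products of the expanded square by lag gives the sum of all autocorrelations, of
    which only lag 0 survives. *)
Lemma perfect_sum_sqr : pm1_row -> perfect_row ->
  (\sum_j h ord0 j) ^+ 2 = p.+1%:R.
Proof.
move=> hpm hperf.
have -> : (\sum_j h ord0 j) ^+ 2 = \sum_k autocorr k.
  rewrite exchange_big /= expr2 mulr_suml; apply: eq_bigr => j _.
  rewrite -mulr_sumr; congr (_ * _).
  by rewrite -[LHS](sum_shift j); apply: eq_bigr => k _; rewrite addrC.
rewrite (bigD1 0) //= [X in _ + X]big1 ?addr0; last by move=> k /hperf.
rewrite /autocorr (eq_bigr (fun=> 1)) ?sumr_const ?card_ord // => j _.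
by rewrite addr0; case: (hpm j) => ->.
Qed.

(* The windows [x x -x x], which mark the left ends of the 1-alternating
   sequences. *)
Definition alternation_starts : {set 'I_p.+1} :=
  [set j | [&& h ord0 j == h ord0 (j + unit_step),
    h ord0 (j + unit_step) != h ord0 (j + unit_step *+ 2) &
    h ord0 (j + unit_step *+ 2) != h ord0 (j + unit_step *+ 3)]].

Let quad (j : 'I_p.+1) : int :=
  h ord0 j * h ord0 (j + unit_step) *
  h ord0 (j + unit_step *+ 2) * h ord0 (j + unit_step *+ 3).

Lemma autocorr_shift (a b : 'I_p.+1) :
  \sum_j h ord0 (j + a) * h ord0 (j + b) = autocorr (b - a).
Proof.
rewrite /autocorr -[RHS](sum_shift a).
by apply: eq_bigr => j _; rewrite -addrA [a + _]addrC subrK.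
Qed.

Lemma card_alternation_starts : (3 < p.+1)%N -> pm1_row -> perfect_row ->
  8 * #|alternation_starts|%:R = p.+1%:R - \sum_j quad j.
Proof.
move=> p3 hpm hperf; set u := unit_step.
have R k l : (k < l < 4)%N ->
    \sum_j h ord0 (j + u *+ k) * h ord0 (j + u *+ l) = 0.
  case/andP=> kl l4; rewrite autocorr_shift -mulrnBr 1?ltnW //.
  by apply/hperf/unit_step_mul_neq0; lia.
rewrite -sum1_card natr_sum mulr_sumr big_mkcond /=.
(* For a window a, b, c, d of signs this is (1 + ab)(1 - bc)(1 - cd) expanded with squares equal to
   1: it is 8 at an alternation start and 0 elsewhere. *)
transitivity (\sum_j (1
    + h ord0 (j + u *+ 0) * h ord0 (j + u *+ 1)
    - h ord0 (j + u *+ 1) * h ord0 (j + u *+ 2)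
    - h ord0 (j + u *+ 2) * h ord0 (j + u *+ 3)
    - h ord0 (j + u *+ 0) * h ord0 (j + u *+ 2)
    + h ord0 (j + u *+ 1) * h ord0 (j + u *+ 3)
    + h ord0 (j + u *+ 0) * h ord0 (j + u *+ 3)
    - quad j)).
  apply: eq_bigr => j _; rewrite inE /quad -/u mulr0n mulr1n addr0.
  by case: (hpm j) => ->; case: (hpm (j + u)) => ->;
     case: (hpm (j + u *+ 2)) => ->; case: (hpm (j + u *+ 3)) => ->.
rewrite !(big_split, sumrN) /= !R // sumr_const card_ord.
by rewrite !(addr0, subr0).
Qed.

(* With [x] and [y] consecutive values of [quad], [x y >= x + y - 1], while
   [x y] is a lag 4 product. *)
Lemma sum_quad_le : (4 < p.+1)%N -> pm1_row -> perfect_row ->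
  2 * \sum_j quad j <= p.+1%:R.
Proof.
move=> p4 hpm hperf.
have R4 : autocorr (unit_step *+ 4) = 0.
  by apply/hperf/unit_step_mul_neq0; lia.
have step j : quad j + quad (j + unit_step) - 1 <=
    h ord0 j * h ord0 (j + unit_step *+ 4).
  rewrite /quad -!addrA -!mulrS.
  by case: (hpm j) => ->; case: (hpm (j + unit_step)) => ->;
     case: (hpm (j + unit_step *+ 2)) => ->;
     case: (hpm (j + unit_step *+ 3)) => ->;
     case: (hpm (j + unit_step *+ 4)) => ->.
have := ler_sum (index_enum 'I_p.+1) (fun j (_ : true) => step j).
rewrite -/(autocorr _) R4 !big_split /= (sum_shift unit_step quad).
by rewrite sumr_const card_ord mulNrn; lra.
Qed.

Lemma perfect_length_le : (4 < p.+1)%N -> pm1_row -> perfect_row ->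
  (p.+1 <= 16 * #|alternation_starts|)%N.
Proof.
move=> p4 hpm hperf; have := sum_quad_le p4 hpm hperf.
by have := card_alternation_starts (ltnW p4) hpm hperf; lia.
Qed.

Definition isolated_entries : {set 'I_p.+1} :=
  [set k | (h ord0 (k - unit_step) != h ord0 k) &&
           (h ord0 k != h ord0 (k + unit_step))].

(** For consecutive signs a, b, c, the product (1 - ab)(1 - bc) = 1 - ab - bc + ac is 4 when b is
    isolated and 0 otherwise; lags 1 and 2 vanish in the sum. *)
Lemma card_isolated_entries : (2 < p.+1)%N -> pm1_row -> perfect_row ->
  (4 * #|isolated_entries| = p.+1)%N.
Proof.
move=> p2 hpm hperf; set u := unit_step.
have R1 : autocorr u = 0 by apply/hperf/(@unit_step_mul_neq0 1); lia.
have R2 : autocorr (u *+ 2) = 0 by apply/hperf/unit_step_mul_neq0; lia.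
suff : (4 * #|isolated_entries|%:R : int) = p.+1%:R by lia.
rewrite -sum1_card natr_sum mulr_sumr big_mkcond /=.
transitivity (\sum_k (1
    - h ord0 (k - u) * h ord0 (k + 0) - h ord0 (k + 0) * h ord0 (k + u)
    + h ord0 (k - u) * h ord0 (k + u))).
  apply: eq_bigr => k _; rewrite inE -/u addr0.
  by case: (hpm k) => ->; case: (hpm (k + u)) => ->;
     case: (hpm (k - u)) => ->.
rewrite !(big_split, sumrN) /= !autocorr_shift opprK add0r subr0 R1 R2.
by rewrite sumr_const card_ord !(addr0, subr0).
Qed.

End Autocorrelation.

(** * Blocks of size 1 and 1-alternating sequences *)

Section Blocks.

Variables (p : nat) (h : 'rV[int]_p.+1).
Hypothesis p_gt0 : (0 < p)%N.

Let u : 'I_p.+1 := unit_step p.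

Lemma addr_unit_step_neq (x : 'I_p.+1) : x + u != x.
Proof.
by rewrite -subr_eq0 addrC addKr; apply: (@unit_step_mul_neq0 p 1); lia.
Qed.

Lemma singleton_blockN (k : 'I_p.+1) :
  is_block h [set k] -> h ord0 (k - u) != h ord0 k /\ h ord0 k != h ord0 (k + u).
Proof.
move=> /maxsetP[_ kmax].
(* Two equal neighbours would form a larger constant arc, against maximality; [x = k - u] and
   [x = k] give the two sides. *)
suff pair x : k \in [set x; x + u] -> h ord0 x != h ord0 (x + u).
  split; last by apply: pair; rewrite !inE eqxx.
  by have := pair (k - u); rewrite subrK; apply; rewrite !inE eqxx orbT.
move=> kx; apply: contraL (addr_unit_step_neq x) => /eqP eqh.
have c2 : #|[set x; x + u]| = 2%N.
  by rewrite cards2 eq_sym addr_unit_step_neq.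
have := kmax [set x; x + u]; rewrite sub1set kx => /(_ _ isT) /= E.
suff /E E1 : consecutive (@ordS p.+1) [set x; x + u] &&
    constant_on h [set x; x + u] by move: c2; rewrite E1 cards1.
apply/andP; split.
  rewrite /consecutive -card_gt0 c2; apply/existsP; exists x.
  by apply/eqP/setP=> y; rewrite !inE /= ordS_add.
by apply/'forall_implyP=> y /set2P[]->; apply/'forall_implyP=> z /set2P[]->;
   rewrite ?eqh.
Qed.

Lemma singleton_block (k : 'I_p.+1) :
  h ord0 (k - u) != h ord0 k -> h ord0 k != h ord0 (k + u) ->
  is_block h [set k].
Proof.
move=> hl hr; apply/maxsetP; split.
  apply/andP; split.
    rewrite /consecutive -card_gt0 cards1; apply/existsP; exists k.
    by apply/eqP/setP=> y; rewrite !inE.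
  by apply/'forall_implyP=> y /set1P->; apply/'forall_implyP=> z /set1P->.
move=> C /andP[/andP[_ /existsP[x /eqP EC]] hC]; rewrite sub1set => kC.
have const y z : y \in C -> z \in C -> h ord0 y = h ord0 z.
  by move=> yC zC; move/'forall_implyP/(_ _ yC)/'forall_implyP/(_ _ zC)/eqP: hC.
have inC i : (i < #|C|)%N -> iter i (@ordS p.+1) x \in C.
  by move=> iC; rewrite EC inE; apply/trajectP; exists i.
have [i iC] : exists2 i, (i < #|C|)%N & k = iter i (@ordS p.+1) x.
  by move: (kC); rewrite {1}EC inE => /trajectP.
(* If [k] is not the first entry of the arc [C], then [k - u] lies in [C], against [hl]; if it is
   first and [C] has a second entry, that entry is [k + u], against [hr]. *)
case: i iC => [|i] iC /= Ek; last first.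
  move: hl; rewrite {1}Ek ordS_add addrK (const _ k) ?eqxx //.
  exact/inC/ltnW.
have [C1|C1] := leqP #|C| 1.
  by apply/eqP; rewrite eq_sym eqEcard sub1set kC cards1.
by have := inC 1%N C1; rewrite /= -Ek ordS_add => /(const _ _ kC) E; rewrite E eqxx in hr.
Qed.

Let singletons : {set {set 'I_p.+1}} := [set B in blocks h | #|B| == 1%N].

Lemma next_block_singleton (x k : 'I_p.+1) :
  next_block h [set x] = [set k] -> k = x + u.
Proof.
rewrite /next_block; case: pickP => [y|/(_ x)]; last first.
  by rewrite !inE eqxx ordS_add addr_unit_step_neq.
rewrite inE => /andP[/eqP-> _]; rewrite ordS_add /pblock.
(* Any block picked contains [x + u], so disjointness of blocks is not at issue; the default [set0]
   of [pblock] is no singleton. *)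
case: pickP => [B /andP[_ /= xB] EB|_ E]; last first.
  by have := set11 k; rewrite -E inE.
by apply/esym/set1P; rewrite -EB.
Qed.

(** In a window starting at j, the entry at [j + u *+ 2] is a block of size 1. Sending j to a
    maximal sequence through this block is injective, because the block must come first in that
    sequence. *)
Lemma card_alternation_starts_le : (#|alternation_starts h| <= alpha1 h)%N.
Proof.
pose P (U : {set {set 'I_p.+1}}) :=
  consecutive (next_block h) U && (U \subset singletons).
have blk j : j \in alternation_starts h -> [set j + u *+ 2] \in singletons.
  rewrite !inE cards1 andbT => /and3P[_ h12 h23].
  have E2 : j + u *+ 2 = j + u + u by rewrite mulr2n addrA.
  have E3 : j + u *+ 3 = j + u *+ 2 + u by rewrite mulrSr addrA.
  by apply: singleton_block; rewrite -?E3 // {1}E2 addrK.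
have PS j : j \in alternation_starts h -> P [set [set j + u *+ 2]].
  move=> /blk jS; rewrite /P sub1set jS andbT /consecutive -card_gt0 cards1.
  by apply/existsP; exists [set j + u *+ 2]; apply/eqP/setP=> B; rewrite !inE.
pose S j := odflt set0
  [pick U | maxset P U && ([set j + u *+ 2] \in (U : {set {set 'I_p.+1}}))].
have SP j : j \in alternation_starts h ->
    maxset P (S j) /\ [set j + u *+ 2] \in S j.
  move=> /PS /maxset_exists[U mU sU]; rewrite /S; case: pickP => [V /andP[]//|].
  by move/(_ U); rewrite mU -sub1set sU.
have <- : #|S @: alternation_starts h| = #|alternation_starts h|.
  apply: card_in_imset => i j iA jA ES.
  have [/maxsetp mS iS] := SP i iA; have [_ jS] := SP j jA.
  rewrite -{}ES in jS.
  case/andP: mS => /andP[_ /existsP[B0 /eqP EU]] /subsetP sS.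
  (* A predecessor in the sequence would be the singleton block at [l + u], but the entries at [l]
     and [l + u] agree. *)
  have head l : l \in alternation_starts h -> [set l + u *+ 2] \in S i ->
      [set l + u *+ 2] = B0.
    move=> lA; rewrite {1}EU inE => /trajectP[[//|q] ltq /= Eq].
    have qS : iter q (next_block h) B0 \in S i.
      by rewrite EU inE; apply/trajectP; exists q => //; apply: ltnW.
    have := sS _ qS; rewrite !inE => /andP[qB /cards1P[x Ex]].
    rewrite Ex in qB Eq; have /esym/next_block_singleton Exl := Eq.
    move: Exl; rewrite mulr2n addrA => /addIr Ex'.
    have [] := singleton_blockN qB; rewrite -Ex' addrK => /negP[].
    by move: lA; rewrite inE => /and3P[].
  have /set1_inj/addIr // : [set i + u *+ 2] = [set j + u *+ 2].
  by rewrite (head i) // (head j).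
apply: subset_leq_card; apply/subsetP=> _ /imsetP[j jA ->]; rewrite inE.
by have [] := SP j jA.
Qed.

(** A 1-alternating sequence is a nonempty subset of [singletons]; when that set has at most one
    element, the two coincide. *)
Lemma alpha1_le1 : (#|isolated_entries h| <= 1)%N -> (alpha1 h <= 1)%N.
Proof.
move=> I1.
have S1 : (#|singletons| <= 1)%N.
  apply: leq_trans I1; rewrite -(card_imset (mem (isolated_entries h)) set1_inj).
  apply: subset_leq_card; apply/subsetP=> B; rewrite !inE => /andP[bB].
  case/cards1P=> k Ek; rewrite Ek in bB *; apply: imset_f; rewrite inE.
  by have [-> ->] := singleton_blockN bB.
rewrite -[X in (_ <= X)%N](cards1 singletons); apply: subset_leq_card.
apply/subsetP=> S; rewrite !inE => /maxsetp /andP[/andP[S0 _] sS].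
by rewrite eqEcard sS (leq_trans S1) // card_gt0.
Qed.

End Blocks.

(** * Exhaustive search at length 16 *)

Fixpoint all_bitseq (n : nat) (P : bitseq -> bool) : bool :=
  if n is n'.+1 then
    all_bitseq n' (fun s => P (true :: s)) &&
    all_bitseq n' (fun s => P (false :: s))
  else P [::].

Lemma all_bitseqP n P s : all_bitseq n P -> size s = n -> P s.
Proof.
elim: n P s => [|n IHn] P [|b s] //= /andP[Pt Pf] [/IHn IHs].
by case: b; [apply: IHs Pt | apply: IHs Pf].
Qed.

(** For signs coded as bits, the autocorrelation at lag [k] is twice this number minus the length,
    so at length 16 it vanishes exactly when the count is 8. *)
Definition agreements (s : bitseq) (k : nat) : nat :=
  count (fun b => b.1 == b.2) (zip s (rot k s)).

(* Nested conditionals, because [vm_compute] evaluates both arguments of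
   [andb]. *)
Lemma no_perfect_bitseq16 :
  all_bitseq 16 (fun s =>
    if agreements s 1 == 8 then
      if agreements s 2 == 8 then
        ~~ all (fun k => agreements s k == 8) (iota 3 6)
      else true
    else true).
Proof. by vm_compute. Qed.

Lemma sum_sign_count (T : Type) (r : seq T) (P : pred T) :
  \sum_(i <- r) (if P i then 1 else -1 : int) =
  2 * (count P r)%:R - (size r)%:R.
Proof.
elim: r => [|x r IHr]; first by rewrite big_nil.
by rewrite big_cons IHr /=; case: (P x); lia.
Qed.

Lemma no_perfect_row16 (h : 'rV[int]_16) : pm1_row h -> ~ perfect_row h.
Proof.
move=> hpm hperf; pose b i := h ord0 (inord i) == 1.
pose s := mkseq b 16; have sz : size s = 16%N by apply: size_mkseq.
(* The search tests lags 1 to 8 only; by symmetry lag 16 - k repeats lag k. *)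
suff agree8 k : (0 < k < 9)%N -> agreements s k == 8.
  have := all_bitseqP no_perfect_bitseq16 sz; rewrite !agree8 //.
  by move/negP; case; apply/allP=> k; rewrite mem_iota => ?; apply: agree8; lia.
move=> kP; have := hperf (inord k); rewrite -val_eqE /= inordK; last by lia.
move=> /(_ ltac:(lia)); rewrite /autocorr.
pose F i := b i == b ((i + k) %% 16)%N.
rewrite (eq_bigr (fun i : 'I_16 => if F i then 1 else -1 : int)); last first.
  move=> i _; rewrite /F /b inord_val.
  have -> : inord ((i + k) %% 16) = i + inord k :> 'I_16.
    by apply: val_inj; rewrite /= !inordK ?ltn_mod //; lia.
  by case: (hpm i) => ->; case: (hpm (i + inord k)) => ->.
rewrite -(big_mkord predT (fun i => if F i then 1 else -1)) sum_sign_count.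
suff -> : agreements s k = count F (index_iota 0 16).
  by rewrite size_iota; lia.
rewrite /agreements; have -> : rot k s = mkseq (fun i => b ((i + k) %% 16)%N) 16.
  apply: (@eq_from_nth _ false) => [|i]; rewrite size_rot ?size_mkseq // => i16.
  rewrite nth_mkseq // /rot nth_cat size_drop sz nth_drop.
  case: ltnP => ik.
    by rewrite nth_mkseq; [congr b; lia | lia].
  by rewrite nth_take; [rewrite nth_mkseq; [congr b; lia | lia] | lia].
by rewrite zip_map count_map.
Qed.

(** * Circulant Hadamard matrices *)

Lemma perfect_defining_row (p : nat) (H : 'M[int]_p.+1) :
  hadamard H -> circulant H -> perfect_row (defining_row H).
Proof.
(* Row [- k] of a circulant matrix has [j + k] as its defining-row index in column [j], so its
   product with row 0 is the autocorrelation at lag [k]. *)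
move=> [_ orth] circ k k0; rewrite -[RHS](orth 0 (- k)); last first.
  by rewrite eq_sym oppr_eq0.
by apply: eq_bigr => j _; rewrite !circ opprK subr0.
Qed.

Theorem theorem2 (p m : nat) (H : 'M[int]_p.+1)
    (hn : p.+1 = (4 * m)%N) (hn1 : (1 < p.+1)%N)
    (hH : pm1_mx H) (halpha : alpha1 (defining_row H) = 2%N) :
  ~ (hadamard H /\ circulant H).
Proof.
case=> hadH circH; have hperf := perfect_defining_row hadH circH.
have hpm : pm1_row (defining_row H) by move=> j; rewrite mxE; apply: hH.
(* At length 4 there is exactly one isolated entry, so [alpha1] cannot be 2. *)
have m1 : m != 1%N.
  apply/eqP=> m1; have := card_isolated_entries _ hpm hperf.
  move=> /(_ ltac:(lia)) I1.
  by have := @alpha1_le1 _ (defining_row H) hn1 ltac:(lia); rewrite halpha.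
have n32 : (p.+1 <= 32)%N.
  have := perfect_length_le _ hpm hperf; move=> /(_ ltac:(lia)).
  by have := card_alternation_starts_le (defining_row H) hn1; rewrite halpha; lia.
have m4 : m = 4%N.
  have := perfect_sum_sqr hpm hperf.
  move: (\sum_j _) => x; rewrite hn; set y := `|x|%N => Ex.
  have Ey : (y * y = 4 * m)%N by rewrite /y; nia.
  have y5 : (y <= 5)%N by nia.
  (* Among 0 to 5 only 0, 2 and 4 have squares divisible by 4; 0 would make the length zero and 2 is
     the excluded [m = 1]. *)
  by move: y5 Ey; clearbody y; do 6?[case: y => [|y]]; lia.
have p15 : p = 15%N by lia.
subst p; exact: no_perfect_row16 hpm hperf.
Qed.
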